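(* Let $K$ be a field and let $\mathcal{C}$ be a polyocollection. Then $I_{\mathcal{C}}$ is a prime ideal of $S_{\mathcal{C}}$ if and only if $I_{\mathcal{C}}=L_{\mathcal{C}}$.
   Context: Intervals: for $a=(i,j)\le b=(k,l)$ in $\mathbb{Z}^2$ (componentwise order), $[a,b]=\{(m,n)\in\mathbb{Z}^2: i\le m\le k,\ j\le n\le l\}$; it is proper if $i<k$ and $j<l$. A proper interval $I=[a,b]$ has diagonal corners $a,b$ and anti-diagonal corners $c=(i,l)$, $d=(k,j)$; $V(I)=\{a,b,c,d\}$ and $E(I)=\{[a,c],[a,d],[d,b],[c,b]\}$ is its set of edges. $\mathrm{c}(I)=\{(m,n)\in\mathbb{R}^2: i\le m\le k,\ j\le n\le l\}$ and $\mathrm{int}(I)=\{(r,s)\in\mathbb{R}^2: i<r<k,\ j<s<l\}$. A polyocollection is a finite collection $\mathcal{C}$ of proper intervals such that for all $I\neq J$ in $\mathcal{C}$ we have $I\nsubseteq J$ and one of the following holds: (1) $I\cap J$ is a common edge of $I$ and $J$; (2) $|F\cap G|\le 1$ for all $F\in E(I)$ and $G\in E(J)$. $V(\mathcal{C})=\bigcup_{I\in\mathcal{C}}V(I)$. An inner interval of $\mathcal{C}$ is an interval $I$ for which there are $I_1,\dots,I_n\in\mathcal{C}$ with $\mathrm{c}(I)=\bigcup_{i=1}^n\mathrm{c}(I_i)$ and $\mathrm{int}(I_k)\cap\mathrm{int}(I_l)=\emptyset$ for $k\ne l$. $S_{\mathcal{C}}=K[x_a:a\in V(\mathcal{C})]$,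 and $I_{\mathcal{C}}$ is the ideal generated by $x_ax_b-x_cx_d$ for all inner intervals $[a,b]$ of $\mathcal{C}$ with diagonal corners $a,b$ and anti-diagonal corners $c,d$. Lattice ideal: for $a\in V(\mathcal{C})$ let $\mathbf{v}_a\in\mathbb{Z}^{|V(\mathcal{C})|}$ be the standard basis vector indexed by $a$, and for $I=[a,b]\in\mathcal{C}$ with anti-diagonal corners $c,d$ put $\mathbf{v}_I=\mathbf{v}_a+\mathbf{v}_b-\mathbf{v}_c-\mathbf{v}_d$. $\Lambda_{\mathcal{C}}$ is the subgroup of $\mathbb{Z}^{|V(\mathcal{C})|}$ generated by $\{\mathbf{v}_I:I\in\mathcal{C}\}$ and $L_{\mathcal{C}}=(x^{\mathbf{e}^+}-x^{\mathbf{e}^-}:\mathbf{e}\in\Lambda_{\mathcal{C}})\subseteq S_{\mathcal{C}}$, where $\mathbf{e}^+$ is obtained from $\mathbf{e}$ by replacing negative entries by $0$ and $\mathbf{e}^-=\mathbf{e}^+-\mathbf{e}$. *)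

(* Defs.v *)
From HB Require Import structures.
From mathcomp Require Import all_boot all_order all_algebra.
From mathcomp Require Import finmap boolp classical_sets reals.
From mathcomp Require Import mpoly.
From mathcomp Require Import zify.

Set Implicit Arguments.
Unset Strict Implicit.
Unset Printing Implicit Defensive.
Import Order.TTheory GRing.Theory Num.Theory.

Local Open Scope classical_set_scope.
Local Open Scope ring_scope.

Definition zpoint : Type := (int * int)%type.

(* A pair of endpoints [(a, b)]; it denotes the interval [a, b] of Z^2 only
   when [is_interval] holds. *)
Definition ival : Type := (zpoint * zpoint)%type.

Definition is_interval (I : ival) : bool :=
  (I.1.1 <= I.2.1) && (I.1.2 <= I.2.2).

Definition proper (I : ival) : bool := (I.1.1 < I.2.1) && (I.1.2 < I.2.2).

(* Diagonal corners a, b and anti-diagonal corners c, d. *)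
Definition crn_a (I : ival) : zpoint := I.1.
Definition crn_b (I : ival) : zpoint := I.2.
Definition crn_c (I : ival) : zpoint := (I.1.1, I.2.2).
Definition crn_d (I : ival) : zpoint := (I.2.1, I.1.2).

Definition corners (I : ival) : seq zpoint :=
  [:: crn_a I; crn_b I; crn_c I; crn_d I].

Definition edges (I : ival) : seq ival :=
  [:: (crn_a I, crn_c I); (crn_a I, crn_d I);
      (crn_d I, crn_b I); (crn_c I, crn_b I)].

Definition lattice_points (I : ival) : set zpoint :=
  [set p | (I.1.1 <= p.1 <= I.2.1) /\ (I.1.2 <= p.2 <= I.2.2)].

Definition closed_cell (R : realType) (I : ival) : set (R * R) :=
  [set p | (I.1.1%:~R <= p.1 <= I.2.1%:~R) /\
           (I.1.2%:~R <= p.2 <= I.2.2%:~R)].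

Definition open_cell (R : realType) (I : ival) : set (R * R) :=
  [set p | (I.1.1%:~R < p.1 < I.2.1%:~R) /\
           (I.1.2%:~R < p.2 < I.2.2%:~R)].

Arguments closed_cell : clear implicits.
Arguments open_cell : clear implicits.

Definition meet_in_common_edge (I J : ival) : Prop :=
  exists F : ival, [/\ F \in edges I, F \in edges J
    & lattice_points I `&` lattice_points J = lattice_points F].

Definition edges_meet_in_points (I J : ival) : Prop :=
  forall F G : ival, F \in edges I -> G \in edges J ->
    is_subset1 (lattice_points F `&` lattice_points G).

Definition polyocollection (C : {fset ival}) : Prop :=
  (forall I, I \in C -> proper I) /\
  (forall I J, I \in C -> J \in C -> I != J ->
     ~ (lattice_points I `<=` lattice_points J) /\
     (meet_in_common_edge I J \/ edges_meet_in_points I J)).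

Definition vertices (C : {fset ival}) : {fset zpoint} :=
  [fset p in flatten [seq corners J | J <- C]]%fset.

Definition inner_interval (R : realType) (C : {fset ival}) (I : ival) : Prop :=
  is_interval I /\
  exists (n : nat) (T : 'I_n -> ival),
    [/\ forall k, T k \in C,
        closed_cell R I = \bigcup_k closed_cell R (T k)
      & trivIset setT (fun k => open_cell R (T k))].

(* S_C = K[x_a : a in V(C)], the variables being numbered by [enum_rank]. *)
Definition polyring (K : fieldType) (C : {fset ival}) : comNzRingType :=
  {mpoly K[#|{: vertices C}|]}.

Definition xvar (K : fieldType) (C : {fset ival}) (a : vertices C) :
  polyring K C := 'X_(enum_rank a).

Definition ideal_gen (A : comNzRingType) (G : set A) : set A :=
  [set f | exists (n : nat) (c g : 'I_n -> A),
     (forall i, G (g i)) /\ f = \sum_(i < n) c i * g i].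

Definition prime_ideal (A : comNzRingType) (P : set A) : Prop :=
  idealr_closed (mem P) /\ prime_idealr_closed (mem P).

(* Taking the corners in [vertices C] discards no inner interval: see
   [inner_interval_corners]. *)
Definition inner_binomials (R : realType) (K : fieldType) (C : {fset ival}) :
  set (polyring K C) :=
  [set f | exists (I : ival) (a b c d : vertices C),
     [/\ inner_interval R C I,
         (fsval a = crn_a I) /\ (fsval b = crn_b I),
         (fsval c = crn_c I) /\ (fsval d = crn_d I)
       & f = xvar K a * xvar K b - xvar K c * xvar K d]].

Arguments inner_binomials : clear implicits.

Definition polyo_ideal (R : realType) (K : fieldType) (C : {fset ival}) :
  set (polyring K C) := ideal_gen (inner_binomials R K C).

Arguments polyo_ideal : clear implicits.

Definition exponents (C : {fset ival}) : zmodType := {ffun vertices C -> int}.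

Definition basis_vec (C : {fset ival}) (p : zpoint) : exponents C :=
  [ffun q : vertices C => if fsval q == p then 1 else 0].

Definition ival_vec (C : {fset ival}) (I : ival) : exponents C :=
  basis_vec C (crn_a I) + basis_vec C (crn_b I)
  - basis_vec C (crn_c I) - basis_vec C (crn_d I).

Definition Lambda (C : {fset ival}) : set (exponents C) :=
  [set e | inIntSpan (in_tuple [seq ival_vec C J | J <- C]) e].

Definition pos_part (C : {fset ival}) (e : exponents C) : exponents C :=
  [ffun q => Num.max (e q) 0].

Definition neg_part (C : {fset ival}) (e : exponents C) : exponents C :=
  pos_part e - e.

(* x^e; the absolute value only casts to nat, as this is used for e >= 0. *)
Definition monom (K : fieldType) (C : {fset ival}) (e : exponents C) :
  polyring K C := \prod_(q : vertices C) xvar K q ^+ `|e q|%N.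

Definition lattice_binomials (K : fieldType) (C : {fset ival}) :
  set (polyring K C) :=
  [set f | exists2 e, Lambda e &
     f = monom K (pos_part e) - monom K (neg_part e)].

Arguments lattice_binomials : clear implicits.

Definition lattice_ideal (K : fieldType) (C : {fset ival}) :
  set (polyring K C) := ideal_gen (lattice_binomials K C).

Arguments lattice_ideal : clear implicits.

Lemma inner_interval_corners (R : realType) (C : {fset ival}) (I : ival) :
  polyocollection C -> inner_interval R C I ->
  {subset corners I <= vertices C}.
Proof.
move=> [Cproper _] [/andP[Ix Iy] [n [T [TC IT _]]]] p pI.
have TI k q : closed_cell R (T k) q -> closed_cell R I q.
  by move=> Tq; rewrite IT; exists k.
have: closed_cell R I (p.1%:~R, p.2%:~R).
  rewrite /closed_cell /= !ler_int.
  by move: pI; rewrite !inE => /or4P[] /eqP -> /=; rewrite !lexx ?Ix ?Iy.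
rewrite IT => -[k _]; rewrite /closed_cell /= !ler_int => -[px py].
have /andP[Tx Ty] := Cproper _ (TC k).
have := TI k ((T k).1.1%:~R, (T k).1.2%:~R).
have := TI k ((T k).2.1%:~R, (T k).2.2%:~R).
rewrite /closed_cell /= !ler_int !lexx (ltW Tx) (ltW Ty) => /(_ (conj isT isT)).
move=> [hx hy] /(_ (conj isT isT)) [lx ly].
rewrite /vertices !inE; apply/flattenP; exists (corners (T k)).
  exact/map_f/TC.
move: pI px py hx hy lx ly Tx Ty; rewrite !inE.
case: p => p1 p2; case: I {Ix Iy IT TI} => [[i j] [k' l]].
case: (T k) => [[a1 a2] [b1 b2]] /=.
rewrite /crn_a /crn_b /crn_c /crn_d /= !xpair_eqE.
lia.
Qed.

(* Main.v *)
From HB Require Import structures.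
Require Import Defs.
From mathcomp Require Import all_boot all_order all_algebra.
From mathcomp Require Import finmap boolp classical_sets reals.
From mathcomp Require Import mpoly zify ring lra.

Set Implicit Arguments.
Unset Strict Implicit.
Unset Printing Implicit Defensive.
Import Order.TTheory GRing.Theory Num.Theory.

Local Open Scope classical_set_scope.
Local Open Scope ring_scope.

(** The ideal [I] of inner 2-minors is always contained in the lattice ideal
    [L], and [L] is always prime; conversely a prime [I] contains [L].  Each of
    these three facts has a short reason.

    [L] is prime because it is a toric ideal.  Two intervals of a
    polyocollection never share their lower left corner, so if the intervals
    are listed in lexicographic order of these corners, the vectors [v_J] form
    a triangular system with ones on the diagonal.  Successively subtracting
    multiples of the [v_J] to cancel the coordinates at the lower left corners
    is therefore an endomorphism of the exponent group whose kernel is exactly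
    the lattice (exists_elimination).  Since the vectors [v_J] have degree zero,
    a large multiple of the degree can be added to every coordinate of this
    endomorphism without changing its kernel.  The images of the basis vectors
    then have natural entries, and [L] is the kernel of a monomial map between
    polynomial rings (lattice_ideal_ker), hence prime.

    For [I] inside [L], the vector of an inner interval has to lie in the
    lattice.  The function on Z^2 that gives the four signed corners of an
    interval is the mixed difference of the indicator function of its unit
    squares, and these indicators add up over a tiling (chi_tiling), so the
    vector of an inner interval is the sum of the vectors of the tiles
    (inner_interval_Lambda).

    If [I] is prime, it contains no monomial, since its elements vanish at the
    point (1, ..., 1).  Monomials may thus be cancelled, and whether
    [x^m - x^m'] lies in [I] depends only on [m - m'].  The differences that
    occur form a group containing every [v_J], hence the whole lattice
    (prime_polyo_Lambda). *)

(** * Ideals *)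

Section IdealGen.
Variables (A : comNzRingType) (G : set A).

Lemma ideal_gen_mem g : G g -> ideal_gen G g.
Proof.
move=> Gg; exists 1%N, (fun=> 1), (fun=> g); split=> //.
by rewrite big_ord1 mul1r.
Qed.

Lemma ideal_gen0 : ideal_gen G 0.
Proof.
by exists 0%N, (fun=> 0), (fun=> 0); split=> [[]|] //; rewrite big_ord0.
Qed.

Lemma ideal_genD f g : ideal_gen G f -> ideal_gen G g -> ideal_gen G (f + g).
Proof.
move=> [n [c [u [Gu ->]]]] [m [d [v [Gv ->]]]].
exists (n + m)%N, (fun i => match split i with inl j => c j | inr j => d j end),
  (fun i => match split i with inl j => u j | inr j => v j end); split=> [i|].
  by case: (split i).
rewrite big_split_ord /=; congr (_ + _); apply: eq_bigr => i _.
  by rewrite -/(unsplit (inl i)) unsplitK.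
by rewrite -/(unsplit (inr i)) unsplitK.
Qed.

Lemma ideal_genM h f : ideal_gen G f -> ideal_gen G (h * f).
Proof.
move=> [n [c [u [Gu ->]]]]; exists n, (fun i => h * c i), u; split=> //.
by rewrite mulr_sumr; apply: eq_bigr => i _; rewrite mulrA.
Qed.

Lemma ideal_genN f : ideal_gen G f -> ideal_gen G (- f).
Proof. by rewrite -mulN1r; exact: ideal_genM. Qed.

Lemma ideal_gen_sum (I : Type) (r : seq I) (F : I -> A) :
  (forall i, ideal_gen G (F i)) -> ideal_gen G (\sum_(i <- r) F i).
Proof.
move=> GF; elim: r => [|i r IHr]; first by rewrite big_nil; exact: ideal_gen0.
by rewrite big_cons; apply: ideal_genD.
Qed.

End IdealGen.

Lemma ideal_gen_least (A : comNzRingType) (G H : set A) :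
  G `<=` ideal_gen H -> ideal_gen G `<=` ideal_gen H.
Proof.
move=> GH f [n [c [g [Gg ->]]]]; apply: ideal_gen_sum => i.
by apply/ideal_genM/GH.
Qed.

Lemma ideal_gen_ker (A : comNzRingType) (B : nzRingType) (G : set A)
    (psi : {rmorphism A -> B}) :
  (forall g, G g -> psi g = 0) -> forall f, ideal_gen G f -> psi f = 0.
Proof.
move=> Gpsi f [n [c [g [Gg ->]]]]; rewrite rmorph_sum big1 // => i _.
by rewrite rmorphM (Gpsi _ (Gg i)) mulr0.
Qed.

Lemma prime_ideal_ker (A : comNzRingType) (B : idomainType)
    (psi : {rmorphism A -> B}) : prime_ideal [set f | psi f = 0].
Proof.
have kerE f : (f \in mem [set f | psi f = 0]) = (psi f == 0).
  by apply/idP/eqP; rewrite ?inE.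
split; first split; rewrite ?kerE ?rmorph0 ?rmorph1 ?oner_eq0 //.
- move=> a u v; rewrite !kerE rmorphD rmorphM => /eqP-> /eqP->.
  by rewrite mulr0 addr0.
- by move=> u v; rewrite !kerE rmorphM mulf_eq0.
Qed.

Lemma prime_idealP (A : comNzRingType) (P : set A) (u v : A) :
  prime_ideal P -> ~ P u -> P (u * v) -> P v.
Proof.
move=> [_ primeP] nPu Puv; have := primeP u v; rewrite !inE => /(_ Puv).
by case/orP; rewrite inE.
Qed.

(** * Monomial maps *)

Section MonomialMap.
Variables (K : fieldType) (n k : nat) (A : 'I_n -> 'X_{1..k}).

Definition monomial_map : {rmorphism {mpoly K[n]} -> {mpoly K[k]}} :=
  comp_mpoly [tuple 'X_[A i] | i < n].

Definition monomial_exp (m : 'X_{1..n}) : 'X_{1..k} :=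
  (\sum_(i < n) A i *+ m i)%MM.

Lemma monomial_mapX m : monomial_map 'X_[m] = 'X_[monomial_exp m].
Proof.
rewrite [LHS]comp_mpolyX [RHS](big_morph _ (@mpolyXD _ _) (@mpolyX0 _ _)).
by apply: eq_bigr => i _; rewrite tnth_mktuple mpolyXn.
Qed.

Lemma monomial_mapE f :
  monomial_map f = \sum_(m <- msupp f) f@_m *: 'X_[monomial_exp m].
Proof.
rewrite {1}[f]mpolyE rmorph_sum; apply: eq_bigr => m _.
by rewrite -monomial_mapX; exact: comp_mpolyZ.
Qed.

(** An element of the kernel has coefficients that sum to zero on every fibre of
    [monomial_exp], so replacing each monomial by a fixed representative of
    its fibre turns it into zero; the replacements cost only binomials. *)
Lemma monomial_ker_binomials (G : set {mpoly K[n]}) (f : {mpoly K[n]}) :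
  (forall m m', monomial_exp m = monomial_exp m' ->
     ideal_gen G ('X_[m] - 'X_[m'])) ->
  monomial_map f = 0 -> ideal_gen G f.
Proof.
move=> Gbin f0; pose rep g := xget 0%MM [set m | monomial_exp m = g].
have repE m : monomial_exp (rep (monomial_exp m)) = monomial_exp m.
  by apply: (@xgetPex _ 0%MM [set m' | monomial_exp m' = _]); exists m.
have rep0 : \sum_(m <- msupp f) f@_m *: 'X_[rep (monomial_exp m)] = 0
    :> {mpoly K[n]}.
  pose gs := undup [seq monomial_exp m | m <- msupp f].
  have fiber m : m \in msupp f -> f@_m *: 'X_[rep (monomial_exp m)] =
      \sum_(g <- gs | monomial_exp m == g) f@_m *: 'X_[rep g] :> {mpoly K[n]}.
    move=> fm; rewrite big_mkcond (bigD1_seq (monomial_exp m)) ?undup_uniq //=.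
      by rewrite eqxx big1 ?addr0 // => g; rewrite eq_sym => /negbTE ->.
    by rewrite mem_undup; exact: map_f.
  rewrite (eq_big_seq _ fiber) (exchange_big_dep xpredT) //= big1 // => g _.
  rewrite -scaler_suml (_ : \sum_(m <- _ | _) _ = 0) ?scale0r //.
  transitivity ((monomial_map f)@_g); last by rewrite f0 mcoeff0.
  rewrite monomial_mapE raddf_sum big_mkcond; apply: eq_bigr => m _ /=.
  by rewrite mcoeffZ mcoeffX; case: eqP; rewrite ?mulr1 ?mulr0.
rewrite -[f]subr0 -rep0 {1}[f]mpolyE -sumrB; apply: ideal_gen_sum => m.
by rewrite -scalerBr -mul_mpolyC; apply/ideal_genM/Gbin; rewrite repE.
Qed.
End MonomialMap.

(** * The exponent lattice *)

Section Lattice.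
Variable C : {fset ival}.
Local Notation V := (vertices C).
Local Notation E := (exponents C).
Local Notation N := #|{: V}|.

Lemma Lambda_sum (a : ival -> int) :
  Lambda (\sum_(J <- C) ival_vec C J *~ a J).
Proof.
pose s := [seq ival_vec C J | J <- C].
have szs : size s = size C by rewrite size_map.
pose J0 : ival := ((0, 0), (0, 0)).
exists [ffun i : 'I_(size s) => a (nth J0 C i)].
rewrite (big_nth J0) -szs big_mkord; apply: eq_bigr => i _.
by rewrite ffunE (nth_map J0) // -szs.
Qed.

Lemma Lambda_ind (P : E -> Prop) :
  P 0 -> (forall e e', P e -> P e' -> P (e - e')) ->
  (forall J, J \in C -> P (ival_vec C J)) -> forall e, Lambda e -> P e.
Proof.
move=> P0 PB PC e [a ->].
have PN u : P u -> P (- u) by rewrite -sub0r; exact: PB.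
have PD u v : P u -> P v -> P (u + v).
  by move=> Pu /PN; rewrite -[in u + v](opprK v); exact: PB.
have PM u n : P u -> P (u *+ n).
  by move=> Pu; elim: n => [|n IHn]; rewrite ?mulr0n // mulrS; apply: PD.
apply: (big_ind P) => // i _.
have Pi : P [seq ival_vec C J | J <- C]`_i.
  by have /mapP[J JC ->] := mem_nth 0 (ltn_ord i); apply: PC.
by case: (a i) => n; [apply: PM | rewrite NegzE mulrNz; apply/PN/PM].
Qed.

Lemma Lambda0 : Lambda (0 : E).
Proof.
have := Lambda_sum (fun=> 0); rewrite big1 // => J _; exact: mulr0z.
Qed.

Lemma LambdaD (e e' : E) : Lambda e -> Lambda e' -> Lambda (e + e').
Proof.
move=> [a ->] [b ->]; exists [ffun i => a i + b i].
by rewrite -big_split; apply: eq_bigr => i _; rewrite ffunE mulrzDr.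
Qed.

Lemma LambdaMz (e : E) n : Lambda e -> Lambda (e *~ n).
Proof.
move=> [a ->]; exists [ffun i => a i * n].
by rewrite mulrz_suml; apply: eq_bigr => i _; rewrite ffunE mulrzA.
Qed.

Lemma Lambda_sum_in (I : Type) (r : seq I) (F : I -> E) :
  (forall i, Lambda (F i)) -> Lambda (\sum_(i <- r) F i).
Proof.
by move=> LF; apply: big_ind => // [|u v]; [exact: Lambda0 | exact: LambdaD].
Qed.

Lemma Lambda_ival J : J \in C -> Lambda (ival_vec C J).
Proof.
move=> JC; have := Lambda_sum (fun I => (I == J)%:R).
rewrite (bigD1_seq J) ?fset_uniq //= eqxx mulr1z big1 ?addr0 //.
by move=> I /negbTE ->; rewrite mulr0z.
Qed.

(** * Eliminating the lower left corners *)

(** The entry of [e] at an arbitrary point of the plane, zero outside the vertex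
    set; this avoids carrying proofs that corners are vertices. *)
Definition coef (e : E) (p : zpoint) : int := \sum_(q | fsval q == p) e q.

Lemma coefB e e' p : coef (e - e') p = coef e p - coef e' p.
Proof.
by rewrite /coef -sumrB; apply: eq_bigr => q _; rewrite !ffunE.
Qed.

Lemma coef_basis r p : p \in V -> coef (basis_vec C r) p = (p == r)%:R.
Proof.
move=> pV; rewrite /coef (big_pred1 [` pV]%fset) => [|q].
  by rewrite ffunE; case: eqP.
by rewrite /= -val_eqE.
Qed.

Fixpoint elim_corners (s : seq ival) (e : E) : E :=
  if s is J :: s' then elim_corners s' (e - ival_vec C J *~ coef e (crn_a J))
  else e.

Lemma elim_cornersB s e e' :
  elim_corners s (e - e') = elim_corners s e - elim_corners s e'.
Proof.
elim: s e e' => //= J s IHs e e'; rewrite -IHs coefB mulrzBr.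
by congr (elim_corners s _); rewrite !opprD !opprK addrACA.
Qed.

HB.instance Definition _ s :=
  GRing.isZmodMorphism.Build E E (elim_corners s) (elim_cornersB s).

Lemma elim_corners_Lambda s e :
  {subset s <= C} -> Lambda (e - elim_corners s e).
Proof.
elim: s e => [|J s IHs] e sC /=; first by rewrite subrr; exact: Lambda0.
set x := ival_vec C J *~ _.
rewrite -[e - _](subrK x); apply: LambdaD.
  rewrite addrAC.
  by apply: IHs => I sI; apply: sC; rewrite inE sI orbT.
by apply: LambdaMz; apply: Lambda_ival; apply: sC; rewrite inE eqxx.
Qed.

(** The pairwise hypothesis says that [ival_vec C I] vanishes at the corners
    eliminated before its own, so it reaches its own step unchanged and is
    sent to zero there. *)
Lemma elim_corners_ival s I :
  pairwise (fun J J' => coef (ival_vec C J') (crn_a J) == 0) s ->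
  all (fun J => coef (ival_vec C J) (crn_a J) == 1) s ->
  I \in s -> elim_corners s (ival_vec C I) = 0.
Proof.
elim: s => //= J s IHs /andP[/allP Js ps] /andP[/eqP J1 s1].
rewrite inE => /orP[/eqP-> | sI].
  by rewrite J1 mulr1z subrr raddf0.
by rewrite (eqP (Js _ sI)) mulr0z subr0 IHs.
Qed.

Hypothesis polyC : polyocollection C.

(** Two distinct intervals with a common lower left corner [(i, j)] could meet
    in neither of the allowed ways: both contain [(i, j)] and [(i + 1, j + 1)],
    which lie on no common edge, and their lower edges share [(i, j)] and
    [(i + 1, j)]. *)
Lemma polyocollection_corner_inj I J :
  I \in C -> J \in C -> crn_a I = crn_a J -> I = J.
Proof.
move=> IC JC eqa; apply/eqP/contraT => nIJ.
have [properC /(_ _ _ IC JC nIJ)[_ edgesC]] := polyC.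
have /andP[I1 I2] := properC _ IC; have /andP[J1 J2] := properC _ JC.
case: edgesC => [[F [FI FJ IJ]]|IJ].
  have [F0 F1] : lattice_points F I.1 /\
      lattice_points F (I.1.1 + 1, I.1.2 + 1).
    rewrite -IJ; move: eqa I1 I2 J1 J2; case: (I) => [[i j] [k l]].
    case: (J) => [[i' j'] [k' l']].
    by rewrite /crn_a /lattice_points /= => -[<- <-]; split; split=> /=; lia.
  exfalso; move: FI I1 I2 F0 F1; case: (I) => [[i j] [k l]].
  rewrite !inE /lattice_points /crn_a /crn_b /crn_c /crn_d /=.
  by move=> /or4P[] /eqP-> /= ? ? [? ?] [? ?]; lia.
have := IJ (crn_a I, crn_d I) (crn_a J, crn_d J).
rewrite !inE !eqxx !orbT => /(_ isT isT (I.1.1, I.1.2) (I.1.1 + 1, I.1.2)).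
move: eqa I1 I2 J1 J2; case: (I) => [[i j] [k l]].
case: (J) => [[i' j'] [k' l']].
rewrite /crn_a /crn_d /lattice_points /= => -[<- <-].
move=> I1 I2 J1 J2 H; exfalso.
have : (i, j) = (i + 1, j) by apply: H; split; split=> /=; lia.
by case; lia.
Qed.

Definition lex_corner (I J : ival) : bool :=
  (I.1.1 < J.1.1) || ((I.1.1 == J.1.1) && (I.1.2 <= J.1.2)).

Lemma mem_vertices J p : J \in C -> p \in corners J -> p \in V.
Proof.
move=> JC pJ; rewrite /vertices !inE; apply/flattenP; exists (corners J) => //.
exact: map_f.
Qed.

Lemma coef_ival I p : p \in V -> coef (ival_vec C I) p =
  (p == crn_a I)%:R + (p == crn_b I)%:R - (p == crn_c I)%:R - (p == crn_d I)%:R.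
Proof.
have coefD e e' r : coef (e + e') r = coef e r + coef e' r.
  by rewrite /coef -big_split; apply: eq_bigr => q _; rewrite ffunE.
by move=> pV; rewrite /ival_vec !coefB coefD !coef_basis.
Qed.

(** Each [e] differs from its image by a lattice vector, so vanishing of the
    image puts [e] in the lattice; conversely the triangular shape of the
    system makes every generator vanish. *)
Lemma exists_elimination : exists phi : {additive E -> E},
  (forall e, Lambda (e - phi e)) /\ (forall e, Lambda e <-> phi e = 0).
Proof.
pose s := sort lex_corner C.
have sC : s =i C by move=> I; rewrite mem_sort.
have lex_tr : transitive lex_corner by rewrite /lex_corner => J I K; lia.
have lex_tot : total lex_corner by rewrite /lex_corner => I J; lia.
have sub_s e : Lambda (e - elim_corners s e).
  by apply: elim_corners_Lambda => I; rewrite sC.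
exists (elim_corners s); split=> // e.
split=> [|e0]; last by rewrite -[e]subr0 -e0; exact: sub_s.
apply: (Lambda_ind (P := fun e => elim_corners s e = 0)) => [|u v|J JC].
- exact: raddf0.
- by rewrite /= elim_cornersB => -> ->; rewrite subrr.
apply: elim_corners_ival; last by rewrite sC; exact: JC.
  have : pairwise (fun I J => lex_corner I J && (I != J)) s.
    rewrite pairwise_relI -uniq_pairwise sort_uniq fset_uniq andbT.
    rewrite -sorted_pairwise //; exact: sort_sorted.
  apply: (sub_in_pairwise (P := mem C)); last by apply/allP => I; rewrite sC.
  (* the corners of a proper interval are lexicographically at least its lower
     left corner, so they all come strictly after that of [I] *)
  move=> I J' IC J'C /andP[lexIJ nIJ]; rewrite coef_ival; last first.
    by apply: (mem_vertices IC); rewrite inE eqxx.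
  have nIJa : crn_a I != crn_a J'.
    by apply: contraNneq nIJ => /(polyocollection_corner_inj IC J'C) ->.
  have /andP[] := polyC.1 _ J'C; move: nIJa lexIJ; rewrite /lex_corner.
  case: (I) => [[i j] [k l]]; case: J' {J'C nIJ} => [[i' j'] [k' l']].
  rewrite /crn_a /crn_b /crn_c /crn_d /= !xpair_eqE; lia.
apply/allP => I; rewrite sC => IC; rewrite coef_ival; last first.
  by apply: (mem_vertices IC); rewrite inE eqxx.
have /andP[] := polyC.1 _ IC; case: (I) => [[i j] [k l]].
rewrite /crn_a /crn_b /crn_c /crn_d /= !xpair_eqE; lia.
Qed.

Lemma degree_Lambda (e : E) : Lambda e -> \sum_q e q = 0.
Proof.
move: e; apply: Lambda_ind => [|e e' e0 e'0|J JC].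
- by rewrite big1 // => q _; rewrite ffunE.
- rewrite (eq_bigr (fun q => e q - e' q)) => [|q _]; last by rewrite !ffunE.
  by rewrite sumrB e0 e'0 subrr.
have deg_basis p : p \in corners J -> \sum_q basis_vec C p q = 1.
  move=> /(mem_vertices JC) pV; rewrite (bigD1 [` pV]%fset) //= ffunE eqxx.
  by rewrite big1 ?addr0 // => q; rewrite -val_eqE ffunE /= => /negbTE ->.
rewrite (eq_bigr (fun q => basis_vec C (crn_a J) q + basis_vec C (crn_b J) q
   - basis_vec C (crn_c J) q - basis_vec C (crn_d J) q)) => [|q _].
  by rewrite !sumrB big_split /= !deg_basis ?inE ?eqxx ?orbT.
by rewrite !ffunE.
Qed.

End Lattice.

(** * Inner intervals lie in the lattice *)

(** Whether the unit square with lower left corner [(m, n)] lies in [I]. *)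
Definition chi (I : ival) (m n : int) : int :=
  ((I.1.1 <= m < I.2.1) && (I.1.2 <= n < I.2.2))%:R.

(** In one variable, the difference of the indicator of [i, k) is the point mass
    at [i] minus that at [k]; the signed corners are the product of two such. *)
Lemma ival_vec_chi (C : {fset ival}) I (q : vertices C) : is_interval I ->
  ival_vec C I q =
    chi I (fsval q).1 (fsval q).2 - chi I ((fsval q).1 - 1) (fsval q).2
    - chi I (fsval q).1 ((fsval q).2 - 1)
    + chi I ((fsval q).1 - 1) ((fsval q).2 - 1).
Proof.
rewrite /ival_vec !ffunE /is_interval /chi.
case: (fsval q) => x y; case: I => [[i j] [k l]].
rewrite /crn_a /crn_b /crn_c /crn_d /= !xpair_eqE => /andP[ik jl].
pose ind (i k x : int) : int := (i <= x < k)%R%:R.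
have ind_diff i' k' x' : i' <= k' ->
    ind i' k' x' - ind i' k' (x' - 1) = (x' == i')%:R - (x' == k')%:R.
  by rewrite /ind; lia.
have andR (b c : bool) : (b && c)%:R = b%:R * c%:R :> int by case: b; case: c.
have ifR (b : bool) : (if b then 1 else 0) = b%:R :> int by case: b.
rewrite !ifR !andR.
transitivity ((ind i k x - ind i k (x - 1)) * (ind j l y - ind j l (y - 1))).
  by rewrite !ind_diff //; ring.
by rewrite /ind !andR; ring.
Qed.

Section Cells.
Variable R : realType.

Lemma half_le (i m : int) : (i%:~R <= m%:~R + 2^-1 :> R) = (i <= m).
Proof.
apply/idP/idP => [|im]; last first.
  have : i%:~R <= m%:~R :> R by rewrite ler_int.
  by lra.
apply: contraTT; rewrite -!ltNge -lezD1 -(ler_int R) rmorphD /=; lra.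
Qed.

Lemma half_lt (i m : int) : (i%:~R < m%:~R + 2^-1 :> R) = (i <= m).
Proof.
apply/idP/idP => [/ltW|im]; first by rewrite half_le.
have : i%:~R <= m%:~R :> R by rewrite ler_int.
by lra.
Qed.

Definition centre (m n : int) : R * R := (m%:~R + 2^-1, n%:~R + 2^-1).

Lemma closed_cell_centre I m n : closed_cell R I (centre m n) <-> chi I m n = 1.
Proof.
rewrite /closed_cell /chi /= !half_le ![_ + _ <= _]leNgt !half_lt -!ltNge.
by case: (_ <= _ < _); case: (_ <= _ < _); split=> // -[].
Qed.

Lemma open_cell_centre I m n : open_cell R I (centre m n) <-> chi I m n = 1.
Proof.
rewrite /open_cell /chi /= !half_lt ![_ + _ < _]ltNge !half_le -!ltNge.
by case: (_ <= _ < _); case: (_ <= _ < _); split=> // -[].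
Qed.

(** The centre of a unit square is in the closed cell of an interval exactly
    when it is in the open one.  So the closed cells say that some tile
    contains the square, and the disjoint open cells that only one does. *)
Lemma chi_tiling I (n : nat) (T : 'I_n -> ival) :
  closed_cell R I = \bigcup_k closed_cell R (T k) ->
  trivIset setT (fun k => open_cell R (T k)) ->
  forall x y, chi I x y = \sum_k chi (T k) x y.
Proof.
move=> IT Tdisj x y; have chi01 J : chi J x y = 0 \/ chi J x y = 1.
  by rewrite /chi; case: (_ && _); [right|left].
have [[k Tk]|nT] := pselect (exists k, chi (T k) x y = 1).
  rewrite (bigD1 k) //= Tk big1 => [|j jk].
    rewrite addr0; apply/closed_cell_centre; rewrite IT.
    by exists k => //; apply/closed_cell_centre.
  have [//|Tj] := chi01 (T j); case/eqP: jk; apply: Tdisj => //.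
  by exists (centre x y); split; apply/open_cell_centre.
rewrite big1 => [|k _]; last first.
  by have [//|Tk] := chi01 (T k); case: nT; exists k.
have [//|/closed_cell_centre] := chi01 I.
by rewrite IT => -[k _ /closed_cell_centre Tk]; case: nT; exists k.
Qed.

Lemma inner_interval_Lambda (C : {fset ival}) I :
  polyocollection C -> inner_interval R C I -> Lambda (ival_vec C I).
Proof.
move=> [properC _] [intI [n [T [TC IT Tdisj]]]].
have chiE := chi_tiling IT Tdisj.
suff -> : ival_vec C I = \sum_k ival_vec C (T k).
  by apply: Lambda_sum_in => k; exact: Lambda_ival.
apply/ffunP => q; rewrite ival_vec_chi // !chiE sum_ffunE.
rewrite -!sumrB -big_split; apply: eq_bigr => k _; rewrite ival_vec_chi //.
by have /andP[Tx Ty] := properC _ (TC k); rewrite /is_interval !ltW.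
Qed.

End Cells.

(** * Monomials *)

Section Monomials.
Variables (K : fieldType) (C : {fset ival}).
Local Notation V := (vertices C).
Local Notation E := (exponents C).
Local Notation N := #|{: V}|.

Definition expo (m : 'X_{1..N}) : E := [ffun q => (m (enum_rank q))%:Z].

(** Left inverse of [expo]; it serves as an exponent of [e] only when [e] has
    nonnegative entries. *)
Definition mexp (e : E) : 'X_{1..N} := [multinom `|e (enum_val i)|%N | i < N].

Lemma expo_inj : injective expo.
Proof.
move=> m m' /ffunP eqm; apply/mnmP => i.
by have := eqm (enum_val i); rewrite !ffunE enum_valK => -[].
Qed.

Lemma expoD m m' : expo (m + m')%MM = expo m + expo m'.
Proof. by apply/ffunP => q; rewrite !ffunE mnmDE. Qed.

Lemma monomE e : monom K e = 'X_[mexp e].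
Proof.
rewrite mpolyXE_id (reindex (@enum_rank V)) /=.
  by apply: eq_bigr => q _; rewrite mnmE enum_rankK.
exact/onW_bij/enum_rank_bij.
Qed.

Lemma expo_mexp_pos e : expo (mexp (pos_part e)) = pos_part e.
Proof.
by apply/ffunP => q; rewrite !ffunE mnmE enum_rankK !ffunE; lia.
Qed.

Lemma expo_mexp_neg e : expo (mexp (neg_part e)) = neg_part e.
Proof.
by apply/ffunP => q; rewrite !ffunE mnmE enum_rankK !ffunE; lia.
Qed.

Lemma expo_mexpB e : expo (mexp (pos_part e)) - expo (mexp (neg_part e)) = e.
Proof. by rewrite expo_mexp_pos expo_mexp_neg /neg_part opprB addrC subrK. Qed.

(** A binomial with exponent difference [e] is a monomial multiple of the
    reduced binomial of [e]. *)
Lemma lattice_ideal_binomial m m' : Lambda (expo m - expo m') ->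
  lattice_ideal K C ('X_[m] - 'X_[m']).
Proof.
move De : (expo m - expo m') => e Le.
pose u := (m - mexp (pos_part e))%MM.
have eE q : e q = (m (enum_rank q))%:Z - (m' (enum_rank q))%:Z.
  by rewrite -De !ffunE.
have mE : m = (u + mexp (pos_part e))%MM.
  by apply/mnmP => i; rewrite mnmDE mnmBE !mnmE !ffunE eE enum_valK; lia.
have m'E : m' = (u + mexp (neg_part e))%MM.
  by apply/mnmP => i; rewrite mnmDE mnmBE !mnmE !ffunE eE enum_valK; lia.
rewrite {1}mE {1}m'E !mpolyXD -mulrBr; apply/ideal_genM/ideal_gen_mem.
by exists e => //; rewrite !monomE.
Qed.

Lemma xvarM (a b : V) :
  xvar K a * xvar K b = 'X_[U_(enum_rank a) + U_(enum_rank b)].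
Proof. by rewrite mpolyXD. Qed.

Lemma expo_corners I (a b c d : V) :
  fsval a = crn_a I -> fsval b = crn_b I ->
  fsval c = crn_c I -> fsval d = crn_d I ->
  expo (U_(enum_rank a) + U_(enum_rank b))%MM
    - expo (U_(enum_rank c) + U_(enum_rank d))%MM = ival_vec C I.
Proof.
move=> aI bI cI dI.
have expo1 (p : V) : expo U_(enum_rank p)%MM = basis_vec C (fsval p).
  apply/ffunP => q; rewrite !ffunE mnm1E (inj_eq enum_rank_inj) eq_sym -val_eqE.
  by case: eqP.
by rewrite !expoD !expo1 aI bI cI dI opprD addrA.
Qed.

Lemma polyo_sub_lattice (R : realType) : polyocollection C ->
  polyo_ideal R K C `<=` lattice_ideal K C.
Proof.
move=> polyC; apply: ideal_gen_least.
move=> _ [I [a [b [c [d [innerI [aI bI] [cI dI] ->]]]]]].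
rewrite !xvarM; apply: lattice_ideal_binomial.
by rewrite (expo_corners aI bI cI dI); exact: inner_interval_Lambda innerI.
Qed.

(** * The lattice ideal is a toric ideal *)

Lemma expo_sum m :
  expo m = \sum_(i < N) basis_vec C (fsval (enum_val i)) *+ m i.
Proof.
apply/ffunP => q; rewrite ffunE sum_ffunE (bigD1 (enum_rank q)) //=.
rewrite big1 => [|i iq].
  by rewrite ffunMnE ffunE enum_rankK eqxx addr0 natz.
rewrite ffunMnE ffunE; case: eqP => [/val_inj qi|]; last by rewrite mul0rn.
by rewrite qi enum_valK eqxx in iq.
Qed.

(** The exponents are the images of the basis vectors under the elimination
    endomorphism, shifted by a constant [B] that makes them natural.  On a
    difference [e] the shift adds [B] times the degree of [e] to every
    coordinate.  This does not enlarge the kernel: the elimination preserves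
    degrees, so the coordinates of the shifted image of [e] add up to the
    degree of [e] times the positive number [1 + N * B]. *)
Lemma exists_toric_exponents : polyocollection C ->
  exists A : 'I_N -> 'X_{1..N}, forall m m',
    Lambda (expo m - expo m') <-> monomial_exp A m = monomial_exp A m'.
Proof.
move=> polyC; have [phi [phi_sub phi0]] := exists_elimination polyC.
pose bv (i : 'I_N) := basis_vec C (fsval (enum_val i)).
pose B := (\sum_(i < N) \sum_(q : V) `|phi (bv i) q|)%N.
pose A i : 'X_{1..N} :=
  [multinom `|(phi (bv i) (enum_val j) + B%:Z)%R|%N | j < N].
have AE i j : (A i j)%:Z = phi (bv i) (enum_val j) + B%:Z.
  rewrite mnmE gez0_abs //; have : (`|phi (bv i) (enum_val j)| <= B)%N.
    rewrite /B (bigD1 i) //= (bigD1 (enum_val j)) //= -addnA; exact: leq_addr.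
  by lia.
have monE m j : (monomial_exp A m j)%:Z =
    phi (expo m) (enum_val j) + B%:Z * \sum_q expo m q.
  have -> : phi (expo m) = \sum_i phi (bv i) *+ m i.
    by rewrite expo_sum raddf_sum; apply: eq_bigr => i _; rewrite raddfMn.
  rewrite (reindex (@enum_val _ V)) /=; last exact/onW_bij/enum_val_bij.
  rewrite mnm_sumE (big_morph Posz PoszD (erefl _)) sum_ffunE.
  rewrite mulr_sumr -big_split; apply: eq_bigr => i _ /=.
  rewrite mulmnE PoszM AE ffunMnE ffunE enum_valK.
  by rewrite -mulr_natr natz; ring.
have ffunB (u v : E) q : (u - v) q = u q - v q by rewrite !ffunE.
exists A => m m'; pose e := expo m - expo m'.
have phiB j : (monomial_exp A m j)%:Z - (monomial_exp A m' j)%:Z =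
    phi e (enum_val j) + B%:Z * \sum_q e q.
  rewrite !monE raddfB ffunB (eq_bigr _ (fun q _ => ffunB _ _ q)) sumrB.
  by ring.
split=> [Le|eqA].
  apply/mnmP => j; apply/eqP; rewrite -eqz_nat -subr_eq0 phiB.
  by rewrite degree_Lambda // ((phi0 _).1 Le) ffunE mulr0 addr0.
have phiE q : phi e q = - (B%:Z * \sum_q e q).
  by apply/eqP; rewrite -addr_eq0 -(enum_rankK q) -phiB eqA subrr.
(* since [phi e] has all entries equal to [- B * deg e], this is the equation
   [(1 + N * B) * deg e = 0] *)
have : \sum_q (e - phi e) q = 0 by rewrite degree_Lambda.
rewrite (eq_bigr (fun q => e q + B%:Z * \sum_q e q)) => [|q _]; last first.
  by rewrite ffunB phiE opprK.
rewrite big_split sumr_const /= => deg0.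
have deg_e : \sum_q e q = 0 by move: deg0; set D := \sum_q e q; nia.
by apply/phi0/ffunP => q; rewrite phiE deg_e mulr0 oppr0 ffunE.
Qed.

(** Two monomials have the same image exactly when their exponents differ by a
    lattice vector, so the kernel is spanned by the binomials of such pairs. *)
Lemma lattice_ideal_ker : polyocollection C ->
  exists psi : {rmorphism polyring K C -> {mpoly K[N]}},
    lattice_ideal K C = [set f | psi f = 0].
Proof.
move=> polyC; have [A AE] := exists_toric_exponents polyC.
exists (monomial_map K A); apply/seteqP; split=> f.
  apply: ideal_gen_ker => {f} _ [e Le ->].
  rewrite !monomE rmorphB /= !monomial_mapX.
  suff /AE -> : Lambda (expo (mexp (pos_part e)) - expo (mexp (neg_part e))).
    by rewrite subrr.
  by rewrite expo_mexpB.
apply: monomial_ker_binomials => m m' /AE; exact: lattice_ideal_binomial.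
Qed.

(** * Prime inner interval ideals contain the lattice ideal *)

Section Prime.
Variable R : realType.
Hypothesis polyC : polyocollection C.
Local Notation IC := (polyo_ideal R K C).

(** Every generator vanishes where all variables are 1, and monomials do not. *)
Lemma polyo_ideal_monom m : ~ IC 'X_[m].
Proof.
move=> /(ideal_gen_ker (psi := meval (fun=> 1 : K))) m0.
have : ('X_[m] : {mpoly K[N]}).@[fun=> 1] = 0.
  apply: m0 => _ [I [a [b [c [d [_ _ _ ->]]]]]].
  by rewrite rmorphB !rmorphM /= !mevalXU subrr.
rewrite mevalX big1 => [/eqP|i _]; last by rewrite expr1n.
by rewrite oner_eq0.
Qed.

Lemma self_inner J : J \in C -> inner_interval R C J.
Proof.
move=> JC; have /andP[J1 J2] := polyC.1 _ JC; split.
  by rewrite /is_interval !ltW.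
exists 1%N, (fun=> J); split=> //.
- by apply/seteqP; split=> p; [move=> Jp; exists ord0 | case].
- by move=> i j _ _ _; rewrite !ord1.
Qed.

Hypothesis primeI : prime_ideal IC.

(** Since [m1' + m2 = m1 + m2'], multiplying the second binomial by [x^m1] gives
    the first one multiplied by [x^m2]; a prime ideal without monomials lets
    [x^m1] be cancelled. *)
Lemma prime_binomial m1 m1' m2 m2' :
  expo m1 - expo m1' = expo m2 - expo m2' ->
  IC ('X_[m1] - 'X_[m1']) -> IC ('X_[m2] - 'X_[m2']).
Proof.
move=> eqm I1; have eqD : (m1' + m2 = m1 + m2')%MM.
  apply: expo_inj; rewrite !expoD; move: eqm => /eqP.
  by rewrite subr_eq addrAC eq_sym subr_eq => /eqP <-; rewrite addrC.
apply: (prime_idealP primeI (@polyo_ideal_monom m1)).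
rewrite mulrBr -!mpolyXD -eqD addmC [(m1' + _)%MM]addmC !mpolyXD -mulrBr.
exact: ideal_genM.
Qed.

(** By [prime_binomial], one binomial of exponent difference [e] in the ideal
    brings in all of them, so the differences that occur form a subgroup; the
    generators of the lattice occur in it because each interval of the
    collection is an inner interval, tiled by itself. *)
Lemma prime_polyo_Lambda e : Lambda e ->
  forall m m', expo m - expo m' = e -> IC ('X_[m] - 'X_[m']).
Proof.
move: e; apply: Lambda_ind =>
  [m m' /subr0_eq/expo_inj ->|e e' Ie Ie' m m' mE|J JC m m' mE].
- by rewrite subrr; exact: ideal_gen0.
- have [p p'] := (expo_mexpB e, expo_mexpB e').
  move: (mexp _) (mexp _) p (mexp _) (mexp _) p' => n1' n1 nE n2' n2 n'E.
  apply: (@prime_binomial (n1 + n2')%MM (n1' + n2)%MM).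
    by rewrite mE -nE -n'E !expoD !opprD opprK addrACA [- expo n2 + _]addrC.
  have -> : 'X_[n1 + n2'] - 'X_[n1' + n2] = 'X_[n2'] * ('X_[n1] - 'X_[n1'])
      - 'X_[n1'] * ('X_[n2] - 'X_[n2']) :> {mpoly K[N]}.
    by rewrite !mpolyXD; ring.
  apply: ideal_genD; first exact/ideal_genM/Ie.
  exact/ideal_genN/ideal_genM/Ie'.
have corner p : p \in corners J -> exists q : V, fsval q = p.
  by move=> /(mem_vertices JC) pV; exists [` pV]%fset.
have /corner[a aJ] : crn_a J \in corners J by rewrite !inE eqxx.
have /corner[b bJ] : crn_b J \in corners J by rewrite !inE eqxx orbT.
have /corner[c cJ] : crn_c J \in corners J by rewrite !inE eqxx !orbT.
have /corner[d dJ] : crn_d J \in corners J by rewrite !inE eqxx !orbT.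
apply: (prime_binomial (etrans (expo_corners aJ bJ cJ dJ) (esym mE))).
rewrite -!xvarM; apply: ideal_gen_mem; exists J, a, b, c, d; split=> //.
exact: self_inner.
Qed.

Lemma lattice_sub_prime_polyo : lattice_ideal K C `<=` IC.
Proof.
apply: ideal_gen_least => _ [e Le ->]; rewrite !monomE.
exact: (prime_polyo_Lambda Le (expo_mexpB e)).
Qed.

End Prime.
End Monomials.

Theorem theorem3p7 (R : realType) (K : fieldType) (C : {fset ival}) :
  polyocollection C ->
  (prime_ideal (polyo_ideal R K C) <-> polyo_ideal R K C = lattice_ideal K C).
Proof.
move=> polyC; split=> [primeI|->].
  apply/seteqP; split; first exact: polyo_sub_lattice.
  exact: lattice_sub_prime_polyo.
have [psi ->] := lattice_ideal_ker K polyC; exact: prime_ideal_ker.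
Qed.
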